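(* Let $q$ be a prime power and $\Delta$ an $n\times n$ diagonal matrix over $\mathbb{F}_q$ with $n$ distinct diagonal entries. For every $C=(c_1<\dots<c_m)\subseteq[n]$ with $|C|=m$ and every partition $\mu=(\mu_1,\dots,\mu_k)$ with positive parts and $\mu_1=m$, the number of $m$-dimensional subspaces of $\mathbb{F}_q^n$ with pivots $C$ and $\Delta$-profile $\mu$ is $$\sigma^C_n(\mu)=(q-1)^{\sum_{j\ge2}\mu_j}q^{\sum_{j\ge2}\binom{\mu_j}{2}}\sum_{T}c_q(T),$$ the sum over all multilinear tableaux $T$ of shape $\mu'$ (the conjugate of $\mu$) whose support is a subset of $[n]$ and whose first column is $C$.
   Context: $W$ has $\Delta$-profile $\mu$ if $\dim(W+\Delta W+\dots+\Delta^{j-1}W)=\mu_1+\dots+\mu_j$ for $1\le j\le k$ and $\dim(W+\dots+\Delta^{k-1}W)=\dim(W+\dots+\Delta^kW)$. An $m$-dimensional subspace $W$ has pivots $C=(c_1<\dots<c_m)$ if the $m\times n$ matrix in reduced row echelon form whose rows span $W$ has its leading $1$ in row $i$ in column $c_i$. A multilinear tableau of shape $\lambda=(\lambda_1,\dots,\lambda_r)$ is an array $(T_{ij})$, $1\le j\le\lambda_i$, of distinct positive integers with rows increasing left to right and columns increasing top to bottom; its support is its set of entries. For $2\le j\le\lambda_i$, $c_{ij}(T)=\#\{i'\ge i:\text{cell }(i',j-1)\text{ exists and }T_{i',j-1}<T_{ij}\}$ and $c_q(T)=\prod_i\prod_{j=2}^{\lambda_i}[c_{ij}(T)]_q$, with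 $[a]_q=1+q+\dots+q^{a-1}$. *)

(* Defs.v *)
From HB Require Import structures.
From mathcomp Require Import all_boot all_order all_algebra.
Set Implicit Arguments. Unset Strict Implicit. Unset Printing Implicit Defensive.
Import GRing.Theory.
Local Open Scope ring_scope.

Section FiniteVspace.
(* Needed for the subtype structure of {vspace vT} over matrices. *)
Import VectorInternalTheory.
Variables (F : finFieldType) (vT : vectType F).
HB.instance Definition _ := [Countable of {vspace vT} by <:].
HB.instance Definition _ := [Finite of {vspace vT} by <:].
End FiniteVspace.

Section Subspaces.
Variables (F : finFieldType) (n : nat).
Implicit Types (D : 'M[F]_n) (W : {vspace 'rV[F]_n}).

(* Vectors of F^n are stored as rows, so a matrix acts on them through its
   transpose. *)
Definition mximg D W : {vspace 'rV[F]_n} := (linfun (mulmxr D^T) @: W)%VS.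

(* W + D W + ... + D^(j-1) W; it is 0 when j = 0. *)
Definition krylov D W (j : nat) : {vspace 'rV[F]_n} :=
  (\sum_(i < j) mximg (D ^+ i) W)%VS.

Definition has_profile D (mu : seq nat) W : bool :=
  [forall j : 'I_(size mu).+1, (0 < j)%N ==>
     (\dim (krylov D W j) == \sum_(i < j) nth 0 mu i)%N]
  && (\dim (krylov D W (size mu)) == \dim (krylov D W (size mu).+1)).

(* M is in reduced row echelon form without zero rows, and the leading 1 of
   its row i is in column c_i. *)
Definition rref_pivots m (c : m.-tuple 'I_n) (M : 'M[F]_(m, n)) : bool :=
  sorted ltn (map val c) &&
  [forall i : 'I_m,
     [&& M i (tnth c i) == 1,
         [forall j : 'I_n, (j < tnth c i)%N ==> (M i j == 0)]
       & [forall i' : 'I_m, (i' != i) ==> (M i' (tnth c i) == 0)]]].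

Definition has_pivots m (c : m.-tuple 'I_n) W : bool :=
  [exists M : 'M[F]_(m, n),
     rref_pivots c M && (<<[seq row i M | i : 'I_m]>>%VS == W)].

Definition sigma D m (c : m.-tuple 'I_n) (mu : seq nat) : nat :=
  #|[set W : {vspace 'rV[F]_n} |
      [&& \dim W == m, has_pivots c W & has_profile D mu W]]|.

End Subspaces.

Local Open Scope nat_scope.

Definition is_partition (mu : seq nat) : bool :=
  sorted geq mu && all (leq 1) mu.

Definition conj_part (mu : seq nat) : seq nat :=
  mkseq (fun i => count (fun p => i < p) mu) (head 0 mu).

(* Rows and columns of a cell are numbered from 0. *)
Definition cell (lam : seq nat) : finType :=
  {i : 'I_(size lam) & 'I_(nth 0 lam i)}.
Definition cell_row lam (x : cell lam) : nat := tag x.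
Definition cell_col lam (x : cell lam) : nat := tagged x.

Section Tableaux.
Variables (n : nat) (lam : seq nat).

(* Fillings with entries in [n]; as for the columns of a matrix, the element
   e of 'I_n stands for the integer e + 1. *)
Implicit Type T : {ffun cell lam -> 'I_n}.

Definition multilinear_tableau T : bool :=
  [&& injectiveb T,
      [forall x, forall y, (cell_row x == cell_row y) &&
         (cell_col x < cell_col y) ==> (T x < T y)]
    & [forall x, forall y, (cell_col x == cell_col y) &&
         (cell_row x < cell_row y) ==> (T x < T y)]].

Definition first_column m (c : m.-tuple 'I_n) T : bool :=
  (size lam == m) &&
  [forall x, (cell_col x == 0) ==> (onth c (cell_row x) == Some (T x))].

Definition c_cell T (x : cell lam) : nat :=
  #|[set y : cell lam | [&& cell_row x <= cell_row y,
                            (cell_col y).+1 == cell_col x & T y < T x]]|.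

Definition qint (q a : nat) : nat := \sum_(i < a) q ^ i.

Definition c_q (q : nat) T : nat :=
  \prod_(x : cell lam | 0 < cell_col x) qint q (c_cell T x).

End Tableaux.

(* Main.v *)
Require Import Defs.
From mathcomp Require Import all_boot all_order all_algebra.
From mathcomp Require Import mxabelem.
From mathcomp Require Import zify.
Set Implicit Arguments. Unset Strict Implicit. Unset Printing Implicit Defensive.
Import GRing.Theory.
Local Open Scope nat_scope.

(** Let W be the row space of a matrix M in reduced row echelon form, and
    restore the columns of M one at a time from left to right.  Let N consist
    of the columns before p, put a = D p p, and let v be column p.  Then e_p
    lies in the j-th Krylov space of N + v e_p iff v is not orthogonal to
    U_j = { w(a) | w a polynomial of degree < j with coefficients in F^m,
    w(D) N = 0 }.  Since D - a is injective on vectors vanishing at p,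
    dividing w by X - a shows dim U_j = m - nu_j, where nu is the profile of
    N.  Hence exactly q^nu_(j-1) - q^nu_j columns v make the Krylov dimensions
    jump from the j-th one on.  Recording these jumps attaches to M a word, of
    which the number of preimages is a product of such differences; reading
    the word as "put p into column j" gives the tableaux, and the words that
    are not lattice words contribute zero because [0]_q = 0. *)

(** * Krylov ranks when one column is restored *)

Section AppendColumn.
Local Open Scope ring_scope.
Variable F : fieldType.

(** The left kernel of [row_mx A B] is the intersection of those of [A] and [B], that is, the kernel
    of [B] restricted to [kermx A]; rank-nullity does the rest. *)
Lemma mxrank_row_mx r n k (A : 'M[F]_(r, n)) (B : 'M_(r, k)) :
  \rank (row_mx A B) = (\rank A + \rank (kermx A *m B)%R)%N.
Proof.
have eqker : (kermx (row_mx A B) :=: kermx A :&: kermx B)%MS.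
  apply/eqmxP/andP; split.
    have /eqP := mulmx_ker (row_mx A B).
    rewrite mul_mx_row -row_mx0 => /eqP/eq_row_mx[kA kB].
    by rewrite sub_capmx; apply/andP; split; apply/sub_kermxP.
  apply/sub_kermxP; rewrite mul_mx_row -[0]row_mx0; congr row_mx;
    apply/sub_kermxP; [exact: capmxSl | exact: capmxSr].
have := mxrank_mul_ker (kermx A) B; rewrite -eqker !mxrank_ker.
have := rank_leq_row A; have := rank_leq_row (row_mx A B); lia.
Qed.

(** As column p of [A] is zero, writing x there amounts to appending x as a new column: each of the
    two matrices is a right multiple of the other. *)
Lemma mxrank_add_delta r n (p : 'I_n) (A : 'M[F]_(r, n)) (x : 'cV_r) :
    col p A = 0 ->
  \rank (A + x *m delta_mx 0 p)%R = (\rank A + (kermx A *m x != 0)%R)%N.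
Proof.
move=> Ap0; set e := delta_mx 0 p : 'rV[F]_n.
have Ae : A *m e^T = 0 by rewrite trmx_delta -colE.
have ee : e *m e^T = 1 by rewrite trmx_delta mul_delta_mx [LHS]mx11_scalar mxE.
have -> : (kermx A *m x != 0) = \rank (kermx A *m x) :> nat.
  rewrite -mxrank_eq0; have := rank_leq_col (kermx A *m x); lia.
rewrite -mxrank_row_mx; apply/eqP; rewrite eqn_leq; apply/andP; split.
  have -> : A + x *m e = row_mx A x *m col_mx 1%:M e.
    by rewrite mul_row_col mulmx1.
  exact: mxrankM_maxl.
have -> : row_mx A x = (A + x *m e) *m row_mx (1%:M - e^T *m e) e^T.
  rewrite mul_mx_row mulmxBr mulmx1 mulmxA mulmxDl Ae -mulmxA ee mulmx1 add0r.
  by rewrite addrK.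
exact: mxrankM_maxl.
Qed.

Variables (m n : nat) (d : 'rV[F]_n).
Local Notation D := (diag_mx d).

(** The blocks M, M D, ..., M D^(j-1) stacked. A row vector w of width [j * m], read as a
    polynomial, is sent to w(D) M. *)
Fixpoint krylov_mx (M : 'M[F]_(m, n)) j : 'M[F]_(j * m, n) :=
  if j is j'.+1 then col_mx M (krylov_mx M j' *m D) else 0.

Section Evaluation.
Variable a : F.

(* A row vector of width j * m is read as a polynomial of degree < j with
   coefficients in F^m: [evalm j] evaluates it at a, [mulXsubm j] multiplies it by
   X - a, and [padm j] regards it as a polynomial of degree < j + 1. *)
Fixpoint evalm j : 'M[F]_(j * m, m) :=
  if j is j'.+1 then col_mx 1%:M (a *: evalm j') else 0.

Fixpoint mulXsubm j : 'M[F]_(j * m, j.+1 * m) :=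
  if j is j'.+1
  then block_mx (- a)%:M (row_mx 1%:M (0 : 'M_(m, j' * m))) 0 (mulXsubm j')
  else 0.

Fixpoint padm j : 'M[F]_(j * m, j.+1 * m) :=
  if j is j'.+1 then block_mx 1%:M 0 0 (padm j') else 0.

Lemma mulXsubm_eval j : mulXsubm j *m evalm j.+1 = 0.
Proof.
elim: j => [|j IHj]; first exact: mul0mx.
etransitivity; first exact: mul_block_col.
rewrite -[RHS]col_mx0; congr col_mx; last first.
  by rewrite mul0mx add0r -scalemxAr IHj scaler0.
rewrite -scalemxAr; have -> : row_mx 1%:M 0 *m evalm j.+1 = 1%:M.
  by etransitivity; [exact: mul_row_col | rewrite mul0mx addr0 mul1mx].
by rewrite mulmx1 scalemx1 -raddfD addNr raddf0.
Qed.

Lemma mulXsubm_krylov M j :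
  mulXsubm j *m krylov_mx M j.+1 = krylov_mx M j *m (D - a%:M).
Proof.
elim: j => [|j IHj]; first by rewrite !mul0mx.
etransitivity; first exact: mul_block_col.
etransitivity; last by symmetry; exact: mul_col_mx.
congr col_mx.
  rewrite mulmxA; have -> : row_mx 1%:M 0 *m krylov_mx M j.+1 = M.
    by etransitivity; [exact: mul_row_col | rewrite mul0mx addr0 mul1mx].
  by rewrite mulmxBr addrC mul_mx_scalar mul_scalar_mx scaleNr.
rewrite mul0mx add0r mulmxA IHj -!mulmxA; congr (_ *m _).
by rewrite mulmxBr mulmxBl scalar_mxC.
Qed.

Lemma padm_krylov M j : padm j *m krylov_mx M j.+1 = krylov_mx M j.
Proof.
elim: j => [|j IHj]; first by rewrite mul0mx.
etransitivity; first exact: mul_block_col.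
by rewrite !mul0mx mul1mx addr0 add0r mulmxA IHj.
Qed.

Lemma padm_eval j : padm j *m evalm j.+1 = evalm j.
Proof.
elim: j => [|j IHj]; first by rewrite mul0mx.
etransitivity; first exact: mul_block_col.
by rewrite !mul0mx mul1mx addr0 add0r -scalemxAr IHj.
Qed.

(* Comparing coefficients from the constant term on does not work when a = 0;
   the summand w is what makes the induction go through. *)
Lemma mulXsubm_inj j (w : 'rV_m) (v : 'rV_(j * m)) :
  row_mx w (0 : 'rV_(j * m)) + v *m mulXsubm j = 0 -> w = 0 /\ v = 0.
Proof.
elim: j w v => [|j IHj] w v.
  rewrite mulmx0 addr0 -[0 in RHS]row_mx0 => /eq_row_mx[-> _]; split=> //.
  by apply/rowP => -[].
rewrite -[v]hsubmxK [_ *m _](@mul_row_block _ _ m (j * m)) add_row_mx add0r.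
rewrite -[0 in RHS]row_mx0 => /eq_row_mx[].
rewrite mul_mx_row mulmx1 !mulmx0 addr0 => e0 /IHj[v0 v1].
by move: e0; rewrite v0 v1 mul0mx addr0 row_mx0.
Qed.

Lemma mulXsubm_free j : row_free (mulXsubm j).
Proof.
apply/inj_row_free => v vS0.
suff /mulXsubm_inj[] : row_mx (0 : 'rV_m) (0 : 'rV_(j * m)) + v *m mulXsubm j = 0 by [].
by rewrite row_mx0 add0r.
Qed.

Lemma evalm_full j : \rank (evalm j.+1) = m.
Proof.
apply/eqP; rewrite eqn_leq rank_leq_col -{1}(mxrank1 F m).
have {1}<- : row_mx 1%:M (0 : 'M_(m, j * m)) *m evalm j.+1 = 1%:M.
  by etransitivity; [exact: mul_row_col | rewrite mul0mx addr0 mul1mx].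
exact: mxrankM_maxr.
Qed.

(** Factor theorem: multiples of X - a vanish at a, and the dimensions agree because evaluation is
    onto. *)
Lemma kermx_evalm j : (kermx (evalm j.+1) :=: mulXsubm j)%MS.
Proof.
apply/eqmx_sym/eqmxP; rewrite -(geq_leqif (mxrank_leqif_eq _)).
  by rewrite mxrank_ker evalm_full (eqP (mulXsubm_free j)) mulSn addKn.
by apply/sub_kermxP/mulXsubm_eval.
Qed.

End Evaluation.

Hypothesis d_inj : injective (d 0).

(** The only zero on the diagonal of D - a is at p, where [A] vanishes. Replacing it by 1 keeps the
    product and makes the diagonal matrix invertible. *)
Lemma mxrank_mul_diag_sub r (p : 'I_n) (A : 'M[F]_(r, n)) :
  col p A = 0 -> \rank (A *m (D - (d 0 p)%:M))%R = \rank A.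
Proof.
move=> Ap0; pose e := \row_j (if j == p then 1 else d 0 j - d 0 p).
have -> : A *m (D - (d 0 p)%:M) = A *m diag_mx e.
  apply/matrixP => i j; rewrite mulmxBr mul_mx_scalar !mul_mx_diag !mxE.
  have [->|_] := eqVneq j p; last by rewrite mulrBr [d 0 p * _]mulrC.
  by move/matrixP/(_ i 0): Ap0; rewrite !mxE => ->; rewrite !(mul0r, mulr0) subr0.
apply: mxrankMfree; rewrite row_free_unit unitmxE det_diag unitfE.
apply/prodf_neq0 => j _; rewrite mxE; case: (eqVneq j p) => [_|jp].
  exact: oner_neq0.
by rewrite subr_eq0; apply: contra jp => /eqP/d_inj->.
Qed.

Lemma col_krylov p M j : col p M = 0 -> col p (krylov_mx M j) = 0.
Proof.
move=> Mp0; elim: j => [|j IHj] /=; first by apply/colP => -[].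
apply/colP => i; rewrite !mxE; case: splitP => k _.
  by move/colP/(_ k): Mp0; rewrite !mxE.
by rewrite mul_mx_diag mxE; move/colP/(_ k): IHj; rewrite !mxE => ->; rewrite mul0r.
Qed.

(** Its row space is U_j: the values at [d 0 p] of the polynomials w of degree < j with w(D) M =
    0. *)
Definition jump_mx p M j := kermx (krylov_mx M j) *m evalm (d 0 p) j.

(** Rank-nullity for evaluation at a on the w of degree < j + 1 with w(D) M = 0. Those vanishing at
    a are (X - a) w', and D - a being injective here, w'(D) M = 0. *)
Lemma mxrank_jump p M j : col p M = 0 ->
  (\rank (jump_mx p M j.+1) + \rank (krylov_mx M j.+1)
     = m + \rank (krylov_mx M j))%N.
Proof.
move=> Mp0; have Kp0 := col_krylov j Mp0.
have := mxrank_mul_ker (kermx (krylov_mx M j.+1)) (evalm (d 0 p) j.+1).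
have := mxrank_mul_ker (mulXsubm (d 0 p) j) (krylov_mx M j.+1).
rewrite mulXsubm_krylov mxrank_mul_diag_sub // (eqP (mulXsubm_free _ _)).
rewrite -/(jump_mx _ _ _).
rewrite (cap_eqmx (eqmx_refl _) (kermx_evalm _ _)) capmxC mxrank_ker.
have := rank_leq_row (krylov_mx M j.+1); have := mulSn j m; lia.
Qed.

Lemma jump_mxS p M j : (jump_mx p M j <= jump_mx p M j.+1)%MS.
Proof.
rewrite /jump_mx -{1}(padm_eval (d 0 p)) mulmxA; apply: submxMr.
by apply/sub_kermxP; rewrite -mulmxA padm_krylov mulmx_ker.
Qed.

(** The row e_p is an eigenvector of D for a = [d 0 p], so the block M D^i gains a^i v e_p. *)
Lemma krylov_add_delta p M (v : 'cV_m) j :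
  krylov_mx (M + v *m delta_mx 0 p) j
    = krylov_mx M j + evalm (d 0 p) j *m v *m delta_mx 0 p.
Proof.
elim: j => [|j IHj] /=; first by rewrite !mul0mx addr0.
rewrite IHj !mul_col_mx add_col_mx mul1mx; congr col_mx.
rewrite mulmxDl -!scalemxAl -[in LHS]mulmxA; congr (_ + _).
by rewrite -rowE row_diag_mx -scalemxAr.
Qed.

Lemma mxrank_krylov_add_delta p M (v : 'cV_m) j : col p M = 0 ->
  \rank (krylov_mx (M + v *m delta_mx 0 p) j)
    = (\rank (krylov_mx M j) + (jump_mx p M j *m v != 0)%R)%N.
Proof.
by move=> Mp0; rewrite krylov_add_delta mxrank_add_delta ?col_krylov ?mulmxA.
Qed.

End AppendColumn.

(** * Words and the heights of their columns *)

Section Words.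

(* A word g on 'I_n places e in column g e of a tableau; its row is then
   [height g (g e) e]. *)
Definition height n (g : 'I_n -> nat) (j p : nat) : nat :=
  #|[set e : 'I_n | (e < p) && (g e == j)]|.

Variables (n : nat) (g : 'I_n -> nat).
Implicit Types (e : 'I_n) (i j p : nat).

Lemma height0 j : height g j 0 = 0.
Proof. by apply/eqP; rewrite cards_eq0; apply/eqP/setP => e; rewrite !inE. Qed.

Lemma heightS j (p : 'I_n) : height g j p.+1 = height g j p + (g p == j).
Proof.
rewrite /height (cardsD1 p) !inE ltnSn addnC; congr (_ + _).
apply: eq_card => e; rewrite !inE ltnS leq_eqVlt.
by have [->|] := eqVneq e p; rewrite ?ltnn // -(inj_eq val_inj) /= => /negPf->.
Qed.

Lemma leq_height j p1 p2 : p1 <= p2 -> height g j p1 <= height g j p2.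
Proof.
move=> le12; apply/subset_leq_card/subsetP => e; rewrite !inE => /andP[lt1 ->].
by rewrite (leq_trans lt1).
Qed.

Lemma ltn_height j e p : e < p -> g e = j -> height g j e < height g j p.
Proof.
move=> lt_ep gej; apply: leq_trans (leq_height j lt_ep).
by rewrite heightS gej eqxx addn1.
Qed.

Lemma height_inj e e' : g e = g e' -> height g (g e) e = height g (g e) e' -> e = e'.
Proof.
move=> eq_g eq_h; apply/val_inj; case: (ltngtP e e') => // lt.
  by have := ltn_height lt (erefl _); rewrite eq_h ltnn.
by have := ltn_height lt (esym eq_g); rewrite eq_h ltnn.
Qed.

(** The height grows by at most one at each step, so it passes through every value below the last
    one, and it leaves a value exactly at an entry of column j. *)
Lemma height_surj i j p : i < height g j p ->
  exists e : 'I_n, [/\ e < p, g e = j & height g j e = i].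
Proof.
elim: p => [|p IHp]; first by rewrite height0.
have [lt_pn|le_np] := ltnP p n; last first.
  (* There are no entries from n on, so the height is constant there. *)
  suff -> : height g j p.+1 = height g j p.
    by move=> /IHp[e [lt_ep ? ?]]; exists e; split=> //; exact: ltnW.
  apply: eq_card => e; rewrite !inE !(leq_trans (ltn_ord e)) //.
  exact: leq_trans le_np _.
rewrite -[p]/(val (Ordinal lt_pn)) heightS /=.
have [lt_i _|ge_i] := ltnP i (height g j p).
  by have [e [lt_ep ? ?]] := IHp lt_i; exists e; split=> //; exact: ltnW.
case: eqP => [gp lt_i|_]; last by rewrite addn0 ltnNge ge_i.
exists (Ordinal lt_pn); split=> //=; lia.
Qed.

(** The successive entries of column j have heights 0, 1, 2, ...; this is the source of the binomial
    exponents of q. *)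
Lemma sum_height_bin j p : p <= n ->
  \sum_(e < n | (e < p) && (g e == j)) height g j e = 'C(height g j p, 2).
Proof.
elim: p => [|p IHp] lt_pn; first by rewrite height0 big_pred0.
pose o := Ordinal lt_pn; rewrite -[p]/(val o) heightS.
have e1 : \sum_(e < n | (e < p) && (g e == j) && (e != o)) height g j e
          = 'C(height g j p, 2).
  rewrite -IHp 1?ltnW //; apply: eq_bigl => e; rewrite -(inj_eq val_inj) /=.
  by have [->|] := eqVneq (e : nat) p; rewrite ?andbF ?andbT ?ltnn.
case: eqP => [gp|gp]; last first.
  rewrite addn0 -e1; apply: eq_bigl => e; rewrite -(inj_eq val_inj) /= ltnS leq_eqVlt.
  case: (eqVneq (e : nat) p) => [ep|_]; last by rewrite andbT.
  have -> : e = o by apply: val_inj.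
  by rewrite andbF; apply/eqP.
rewrite (bigD1 o) /=; last by rewrite ltnSn gp eqxx.
rewrite addn1 binS bin1 -e1 addnC; congr (_ + _); apply: eq_bigl => e.
rewrite -(inj_eq val_inj) /= ltnS leq_eqVlt.
by have [->|ne] := eqVneq (e : nat) p; rewrite ?andbF ?ltnn // orFb.
Qed.

End Words.

(** * Counting reduced echelon matrices by their words *)

Section Counting.
Local Open Scope ring_scope.

Lemma card_cokernel (F : finFieldType) r m (U : 'M[F]_(r, m)) :
  #|[set v : 'cV[F]_m | U *m v == 0]| = (#|F| ^ (m - \rank U))%N.
Proof.
rewrite -mxrank_tr -mxrank_ker -card_rowg -(card_imset _ (@trmx_inj F m 1)).
apply: eq_card => u; rewrite inE; apply/imsetP/sub_kermxP => [[v]|uU].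
  by rewrite inE => /eqP Uv ->; rewrite -trmx_mul Uv trmx0.
exists u^T; last by rewrite trmxK.
by rewrite inE; apply/eqP/trmx_inj; rewrite trmx_mul trmxK uU trmx0.
Qed.

(** A monotone predicate is determined by its switching point, so only t and t + 1 need checking;
    for t = K the range ends before t + 1. *)
Lemma threshold_eq (b : nat -> bool) K t :
    (forall j, b j -> b j.+1) -> (t <= K)%N ->
  [forall j : 'I_K.+1, b j == (t < j)%N] = ~~ b t && ((t < K)%N ==> b t.+1).
Proof.
move=> bS le_tK; have b_mono i j : (i <= j)%N -> b i -> b j.
  by move=> /subnKC<-; elim: (j - i)%N => [|k IHk]; rewrite ?addn0 // addnS => /IHk/bS.
apply/forallP/andP => [bP|[nbt btS] j].
  have leK : (t < K.+1)%N by [].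
  have := bP (Ordinal leK); rewrite /= ltnn => /eqP->; split=> //.
  by apply/implyP => ltK; have := bP (Ordinal (ltK : (t.+1 < K.+1)%N));
    rewrite /= ltnSn => /eqP.
apply/eqP; have [lt_tj|le_jt] := ltnP t j; last first.
  by apply/negbTE; apply: contra nbt; apply: b_mono.
apply: (b_mono t.+1) => //; apply: (implyP btS); exact: leq_trans lt_tj (ltn_ord j).
Qed.

Lemma threshold_exists (b : nat -> bool) K :
    (forall j, b j -> b j.+1) -> ~~ b 0%N ->
  exists t : 'I_K.+1, [forall j : 'I_K.+1, b j == (t < j)%N].
Proof.
move=> bS b0; suff [t [le_tK nbt btS]] :
    exists t, [/\ (t <= K)%N, ~~ b t & (t < K)%N ==> b t.+1].
  exists (Ordinal (le_tK : (t < K.+1)%N)).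
  by rewrite (threshold_eq bS) //= nbt.
elim: K => [|K [t [le_tK nbt btS]]]; first by exists 0%N.
have [lt_tK|ge_tK] := ltnP t K.
  by exists t; split; rewrite ?(implyP btS) ?implybT // ltnW.
have {ge_tK le_tK} eq_tK : t = K by apply/eqP; rewrite eqn_leq le_tK.
move: nbt; rewrite eq_tK => nbK; case bK: (b K.+1).
  by exists K; rewrite bK implybT leqnSn.
by exists K.+1; rewrite bK ltnn leqnn.
Qed.

Variables (F : finFieldType) (m n K : nat) (d : 'rV[F]_n) (c : m.-tuple 'I_n).
Hypothesis d_inj : injective (d 0).
Hypothesis c_inj : injective (tnth c).
Hypothesis K_gt0 : (0 < K)%N.

Implicit Types (M : 'M[F]_(m, n)) (v : 'cV[F]_m).

Definition trunc_mx p M : 'M[F]_(m, n) :=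
  \matrix_(i, j) if (j < p)%N then M i j else 0.

(* The first p columns of a matrix in reduced row echelon form with pivots c,
   completed by zero columns; the rows with a pivot in column >= p vanish. *)
Definition rref_upto p M : bool :=
  [forall i, forall j : 'I_n, ((p <= j) || (j < tnth c i))%N ==> (M i j == 0)]
  && [forall i, (tnth c i < p)%N ==> (col (tnth c i) M == delta_mx i 0)].

Lemma rref_uptoP p M :
  reflect ((forall i (j : 'I_n), ((p <= j) || (j < tnth c i))%N -> M i j = 0)
          /\ (forall i i', (tnth c i < p)%N -> M i' (tnth c i) = (i' == i)%:R))
          (rref_upto p M).
Proof.
apply: (iffP andP) => [[/forallP M1 /forallP M2]|[M1 M2]]; split.
- by move=> i j ij; have /forallP/(_ j)/implyP/(_ ij)/eqP := M1 i.
- move=> i i' /(implyP (M2 i))/eqP/matrixP/(_ i' 0).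
  by rewrite !mxE eqxx andbT.
- by apply/forallP => i; apply/forallP => j; apply/implyP => /M1->.
apply/forallP => i; apply/implyP => lt_ip; apply/eqP/matrixP => i' j.
by rewrite !mxE M2 // ord1 eqxx andbT.
Qed.

Lemma trunc_id p M : rref_upto p M -> trunc_mx p M = M.
Proof.
case/rref_uptoP => M1 _; apply/matrixP => i j; rewrite mxE.
by case: ltnP => // le_pj; rewrite M1 ?le_pj.
Qed.

Lemma trunc_trunc p1 p2 M : (p1 <= p2)%N -> trunc_mx p1 (trunc_mx p2 M) = trunc_mx p1 M.
Proof.
move=> le12; apply/matrixP => i j; rewrite !mxE.
by case: ltnP => // lt_j; rewrite (leq_trans lt_j).
Qed.

Lemma trunc0 M : trunc_mx 0 M = 0.
Proof. by apply/matrixP => i j; rewrite !mxE. Qed.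

Lemma col_trunc (p : 'I_n) M : col p (trunc_mx p M) = 0.
Proof. by apply/matrixP => i j; rewrite !mxE ltnn. Qed.

Lemma truncS (p : 'I_n) M :
  trunc_mx p.+1 M = trunc_mx p M + col p M *m delta_mx 0 p.
Proof.
apply/matrixP => i j; rewrite !mxE big_ord1 !mxE /= ltnS leq_eqVlt.
rewrite -(inj_eq val_inj) /=.
have [/val_inj ->|_] /= := eqVneq (j : nat) p; last by rewrite mulr0 addr0.
by rewrite ltnn mulr1 add0r.
Qed.

Lemma trunc_add_delta (p : 'I_n) M v :
  rref_upto p M -> trunc_mx p (M + v *m delta_mx 0 p) = M.
Proof.
move=> /trunc_id defM; apply/matrixP => i j; rewrite -[in RHS]defM !mxE.
case: ltnP => // lt_jp; rewrite big_ord1 !mxE (ltn_eqF lt_jp : (j == p) = false).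
by rewrite andbF mulr0 addr0.
Qed.

Lemma rref_trunc (p : 'I_n) M : rref_upto p.+1 M -> rref_upto p (trunc_mx p M).
Proof.
case/rref_uptoP => M1 M2; apply/rref_uptoP; split => [i j|i i' lt_ip].
  rewrite mxE; case: (ltnP j p) => //= lt_jp lt_ji; apply: M1.
  by rewrite lt_ji orbT.
by rewrite mxE lt_ip M2 // ltnS ltnW.
Qed.

Lemma rref_upto0 M : rref_upto 0 M = (M == 0).
Proof.
apply/rref_uptoP/eqP => [[M1 _]|->]; last by split=> // i j; rewrite mxE.
by apply/matrixP => i j; rewrite M1 ?mxE.
Qed.

Lemma jump_mx0 p M (v : 'cV_m) : jump_mx d p M 0 *m v = 0.
Proof. by rewrite /jump_mx mulmx0 mul0mx. Qed.

(** Polynomials of degree < 1 are constants, so U_1 is the left kernel of [M]. The zero block of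
    width [0 * m] only fits the dimensions. *)
Lemma jump_mx1P (p : 'I_n) M v :
  reflect (forall u : 'rV_m, u *m M = 0 -> u *m v = 0) (jump_mx d p M 1 *m v == 0).
Proof.
have kry (u : 'rV_m) : row_mx u (0 : 'rV_(0 * m)) *m krylov_mx d M 1 = u *m M.
  by etransitivity; [exact: mul_row_col | rewrite mul0mx addr0].
have evl (u : 'rV_m) : row_mx u (0 : 'rV_(0 * m)) *m evalm m (d 0 p) 1 = u.
  by etransitivity; [exact: mul_row_col | rewrite mul0mx addr0 mulmx1].
apply: (iffP eqP) => [jv u uM|uv].
  have /submxP[w defu] : (row_mx u (0 : 'rV_(0 * m)) <= kermx (krylov_mx d M 1))%MS.
    by apply/sub_kermxP; rewrite kry.
  have -> : u *m v = w *m (jump_mx d p M 1 *m v).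
    by rewrite -{1}[u]evl defu /jump_mx !mulmxA.
  by rewrite jv mulmx0.
apply/row_matrixP => i; rewrite row0 /jump_mx -mulmxA row_mul.
have := congr1 (row i) (mulmx_ker (krylov_mx d M 1)).
rewrite row0 row_mul; move: (row i _) => w.
have -> : w = row_mx (lsubmx (w : 'rV_(m + 0 * m))) (0 : 'rV_(0 * m)).
  by rewrite -[LHS]hsubmxK; congr row_mx; apply/rowP => -[].
by rewrite kry mulmxA evl; apply: uv.
Qed.

Lemma jump_mx_mono (p : 'I_n) M v j :
  jump_mx d p M j *m v != 0 -> jump_mx d p M j.+1 *m v != 0.
Proof.
apply: contraNneq => jv0; have /submxP[B ->] := jump_mxS d p M j.
by rewrite -mulmxA jv0 mulmx0.
Qed.

(** The rows of [M] with pivot before p are independent and the others are zero. Hence v is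
    orthogonal to the left kernel of [M] iff it is supported on the former rows, which is what
    echelon form asks of column p. *)
Lemma rref_add_nonpivot (p : 'I_n) M v : rref_upto p M -> p \notin c ->
  rref_upto p.+1 (M + v *m delta_mx 0 p) = (jump_mx d p M 1 *m v == 0).
Proof.
move=> /[dup] MR /rref_uptoP[M1 M2] pNc.
have entE i j : (M + v *m delta_mx 0 p) i j = M i j + v i 0 * (j == p)%:R.
  by rewrite !mxE big_ord1 !mxE.
have cp i : (tnth c i == p) = false.
  by apply: contraNF pNc => /eqP <-; exact: mem_tnth.
apply/rref_uptoP/jump_mx1P => [[N1 N2] u uM|uv].
  apply/rowP => k; rewrite ord1 !mxE big1 // => i _.
  have [lt_ip|lt_pi|/val_inj/eqP] := ltngtP (tnth c i) p; last by rewrite cp.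
    move/rowP/(_ (tnth c i)): uM; rewrite !mxE (bigD1 i) //= M2 // eqxx mulr1.
    rewrite big1 => [|i' /negPf ne]; last by rewrite M2 // ne mulr0.
    by rewrite addr0 => ->; rewrite mul0r.
  have := N1 i p; rewrite lt_pi orbT entE eqxx mulr1 M1 ?leqnn // add0r.
  by move=> -> //; rewrite mulr0.
split=> [i j|i i' lt_ip]; last first.
  rewrite entE cp mulr0 addr0 M2 //.
  by move: lt_ip; rewrite ltnS leq_eqVlt (inj_eq val_inj) cp.
rewrite entE; have [-> /orP[|lt_pi]|jp ij] := eqVneq j p.
- by rewrite ltnn.
- rewrite M1 ?leqnn // add0r mulr1.
  have := uv (delta_mx 0 i); rewrite -!rowE => /(_ _)/rowP/(_ 0); rewrite !mxE; apply.
  apply/rowP => k; rewrite !mxE M1 //.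
  by case: (leqP p k) => //= lt_kp; exact: ltn_trans lt_kp lt_pi.
rewrite mulr0 addr0 M1 //; case/orP: ij => [/ltnW->//|->]; exact: orbT.
Qed.

Lemma rref_add_pivot (i : 'I_m) M v : rref_upto (tnth c i) M ->
  rref_upto (tnth c i).+1 (M + v *m delta_mx 0 (tnth c i)) = (v == delta_mx i 0).
Proof.
set p := tnth c i; move=> /[dup] MR /rref_uptoP[M1 M2].
have entE k j : (M + v *m delta_mx 0 p) k j = M k j + v k 0 * (j == p)%:R.
  by rewrite !mxE big_ord1 !mxE.
apply/rref_uptoP/eqP => [[_ N2]|defv].
  apply/matrixP => k z; rewrite ord1 !mxE eqxx andbT.
  by have := N2 i k (ltnSn _); rewrite entE eqxx mulr1 M1 ?leqnn // add0r.
have {}entE k j : (M + v *m delta_mx 0 p) k j = M k j + (k == i)%:R * (j == p)%:R.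
  by rewrite entE defv mxE eqxx andbT.
split=> [k j|k k']; rewrite entE.
  have [-> /orP[|lt_pk]|jp kj] := eqVneq j p.
  - by rewrite ltnn.
  - rewrite M1 ?leqnn // add0r; case: eqVneq lt_pk => [->|]; rewrite ?ltnn //.
    by rewrite mul0r.
  by rewrite mulr0 addr0 M1 //; case/orP: kj => [/ltnW->//|->]; exact: orbT.
rewrite ltnS leq_eqVlt => /orP[/eqP/val_inj eq_p|lt_p].
  by rewrite eq_p eqxx mulr1 M1 ?leqnn // add0r (c_inj eq_p).
by rewrite M2 // (ltn_eqF lt_p : (_ == p) = false) mulr0 addr0.
Qed.

(** Row i is still zero before its pivot, so a pivot column already enlarges the first Krylov
    space. *)
Lemma jump_mx_pivot (i : 'I_m) M : rref_upto (tnth c i) M ->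
  jump_mx d (tnth c i) M 1 *m (delta_mx i 0 : 'cV_m) != 0.
Proof.
move=> /rref_uptoP[M1 _]; apply/negP => /jump_mx1P/(_ (delta_mx 0 i)).
rewrite mul_delta_mx -rowE => uv; suff /uv/matrixP/(_ 0 0) : row i M = 0.
  by rewrite !mxE => /eqP; rewrite oner_eq0.
by apply/rowP => k; rewrite !mxE M1 //; case: leqP.
Qed.

(** The number of fillings of a column with jump index t, where [b] tells whether it is a pivot
    column. A pivot column is forced and has t = 0; any other column has t > 0. For t = K no later
    space is recorded, so nothing is subtracted. *)
Definition col_weight (q : nat) (b : bool) (nu : nat -> nat) (t : nat) : nat :=
  (if t == 0 then nat_of_bool b
   else ~~ b * (q ^ nu t.-1 - (if t == K then 0 else q ^ nu t)))%N.

Lemma card_column (p : 'I_n) M (nu : nat -> nat) (t : nat) :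
    rref_upto p M -> (t <= K)%N ->
    (forall j, (j <= K)%N -> \rank (krylov_mx d M j) = \sum_(i < j) nu i)%N ->
  #|[set v : 'cV[F]_m | rref_upto p.+1 (M + v *m delta_mx 0 p)
      && [forall j : 'I_K.+1, (jump_mx d p M j *m v != 0) == (t < j)%N]]|
    = col_weight #|F| (p \in c) nu t.
Proof.
move=> MR le_tK rkM; have Mp0 : col p M = 0 by rewrite -(trunc_id MR) col_trunc.
(* The codimension of U_(j+1) is the profile entry [nu j], numbered from 0. *)
have rkU j : (j < K)%N -> (m - \rank (jump_mx d p M j.+1))%N = nu j.
  move=> lt_jK; have := mxrank_jump d_inj j Mp0.
  rewrite (rkM j.+1) // (rkM j) 1?ltnW // big_ord_recr /=; lia.
have mono v := jump_mx_mono (p := p) (M := M) (v := v).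
have thrE v := threshold_eq (mono v) le_tK.
rewrite /col_weight; case: (boolP (p \in c)) => [/tnthP[i pi]|pNc].
  have jump1 : jump_mx d p M 1 *m (delta_mx i 0 : 'cV_m) != 0.
    by rewrite pi; apply: jump_mx_pivot; rewrite -pi.
  have pivE v : rref_upto p.+1 (M + v *m delta_mx 0 p) = (v == delta_mx i 0).
    by rewrite pi rref_add_pivot -?pi.
  have [t0|t_gt0] := posnP t.
    rewrite (_ : [set _ | _] = [set delta_mx i 0]) ?cards1 //.
    apply/setP => v; rewrite !inE thrE t0 jump_mx0 eqxx K_gt0 /= pivE.
    by apply/andb_idr => /eqP ->.
  rewrite mul0n; apply/eqP; rewrite cards_eq0; apply/eqP/setP => v.
  rewrite !inE pivE; apply/negP => /andP[/eqP -> /forallP].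
  by move=> /(_ (Ordinal (K_gt0 : (1 < K.+1)%N)))/=; rewrite jump1 ltnNge t_gt0.
have [t0|t_gt0] := posnP t.
  apply/eqP; rewrite cards_eq0; apply/eqP/setP => v; rewrite !inE thrE t0.
  by rewrite rref_add_nonpivot // K_gt0 /=; case: eqP; rewrite ?andbF.
(* The spaces [A j] decrease with j. The columns sought lie in [A t] and, if t < K, outside
   [A t.+1]; since t > 0 they lie in [A 1], so echelon form is automatic. *)
rewrite mul1n; pose A j := [set v : 'cV[F]_m | jump_mx d p M j *m v == 0].
have cardA j : (j < K)%N -> #|A j.+1| = (#|F| ^ nu j)%N.
  by move=> lt_jK; rewrite card_cokernel rkU.
have subA i j : (i <= j)%N -> A j \subset A i.
  move=> /subnKC <-; elim: (j - i)%N => [|k IHk]; first by rewrite addn0.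
  rewrite addnS; apply: subset_trans IHk; apply/subsetP => v; rewrite !inE.
  exact/contraLR/mono.
rewrite -cardA ?prednK //.
have -> : [set v : 'cV[F]_m | rref_upto p.+1 (M + v *m delta_mx 0 p)
      && [forall j : 'I_K.+1, (jump_mx d p M j *m v != 0) == (t < j)%N]]
  = A t :\: (if t == K then set0 else A t.+1).
  apply/setP => v; rewrite !inE thrE rref_add_nonpivot // negbK.
  have := subsetP (subA 1%N t t_gt0) v; rewrite !inE.
  rewrite ltn_neqAle le_tK andbT; case: (eqVneq t K) => /= _ At.
    by rewrite inE andbT (andb_idl At).
  by rewrite inE andbA (andb_idl At) andbC.
rewrite cardsD; case: (eqVneq t K) => [_|t_neq]; first by rewrite setI0 cards0.
by rewrite (setIidPr (subA _ _ (leqnSn t))) cardA // ltn_neqAle t_neq.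
Qed.

Local Notation rk M j := (\rank (krylov_mx d M j)).

(** Counts the e < p with letter below j: the j-th Krylov rank that word g prescribes for the
    truncation at p. *)
Definition word_rank (g : 'I_n -> nat) p j : nat := (\sum_(i < j) height g i p)%N.

Lemma word_rank0 g j : word_rank g 0 j = 0%N.
Proof. by rewrite /word_rank big1 // => i _; rewrite height0. Qed.

Lemma word_rankS g (p : 'I_n) j :
  word_rank g p.+1 j = (word_rank g p j + (g p < j))%N.
Proof.
rewrite /word_rank (eq_bigr _ (fun (i : 'I_j) _ => heightS g i p)) big_split /=.
congr (_ + _)%N; have [lt_gj|le_jg] := ltnP (g p) j.
  rewrite (bigD1 (Ordinal lt_gj)) //= eqxx big1 // => i.
  by rewrite -(inj_eq val_inj) eq_sym => /negPf /= ->.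
by rewrite big1 // => i _; rewrite gtn_eqF // (leq_trans _ le_jg).
Qed.

(* g e is the least j such that the (j+1)-st Krylov space of the truncation of
   M grows in dimension when its column e is restored; it is K if there is no
   such j < K. *)
Fixpoint has_word (g : 'I_n -> nat) p M : bool :=
  if p is p'.+1 then
    has_word g p' M
    && [forall j : 'I_K.+1, rk (trunc_mx p M) j == word_rank g p j]
  else true.

Lemma has_word_rank g p M j :
  has_word g p M -> (j <= K)%N -> rk (trunc_mx p M) j = word_rank g p j.
Proof.
case: p => [_ _|p /andP[_ /forallP rkE] le_jK]; last first.
  by have /eqP := rkE (Ordinal (le_jK : (j < K.+1)%N)).
rewrite trunc0 word_rank0; apply/eqP; rewrite mxrank_eq0; apply/eqP.
by elim: j => [|j IHj] //=; rewrite IHj mul0mx col_mx0.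
Qed.

Lemma has_word_trunc g p1 p2 M :
  (p1 <= p2)%N -> has_word g p1 (trunc_mx p2 M) = has_word g p1 M.
Proof.
elim: p1 => //= p1 IHp le12; rewrite trunc_trunc // IHp //; exact: ltnW.
Qed.

Lemma eqb_nat (a b : bool) : (a == b :> nat) = (a == b).
Proof. by case: a b => [] []. Qed.

(** Matrices are grouped by their truncation N at p. The word prescribes the Krylov ranks of N up to
    K, so by [card_column] all fibres have the same size. *)
Lemma card_has_wordS g (p : 'I_n) : (g p <= K)%N ->
  #|[set M | rref_upto p.+1 M && has_word g p.+1 M]|
  = (#|[set M | rref_upto p M && has_word g p M]|
     * col_weight #|F| (p \in c) (fun j => height g j p) (g p))%N.
Proof.
move=> le_gK; rewrite -sum1_card.
rewrite (partition_big (trunc_mx p) (fun N => rref_upto p N && has_word g p N)) /=.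
  rewrite -sum_nat_const; apply: eq_big => [N|N /andP[NR Nw]]; first by rewrite inE.
  have rkN j : (j <= K)%N -> rk N j = word_rank g p j.
    by move=> le_jK; rewrite -{1}(trunc_id NR); apply: has_word_rank.
  have Np0 : col p N = 0 by rewrite -(trunc_id NR) col_trunc.
  rewrite -(card_column NR le_gK rkN).
  rewrite -[RHS](card_imset (f := fun v => N + v *m delta_mx 0 p)).
    rewrite sum1_card; apply: eq_card => M; rewrite unfold_in /= !inE.
    apply/idP/imsetP => [/andP[/andP[MR Mw] /eqP MN]|[v]].
      have defM : M = N + col p M *m delta_mx 0 p by rewrite -MN -truncS trunc_id.
      exists (col p M) => //; rewrite inE -defM MR /=; apply/forallP => j.
      case/andP: Mw => _ /forallP/(_ j); rewrite trunc_id // word_rankS -rkN -1?ltnS //.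
      by rewrite {1}defM mxrank_krylov_add_delta // eqn_add2l eqb_nat.
    rewrite inE => /andP[MR /forallP jv] ->.
    have tr := trunc_add_delta v NR.
    rewrite MR tr eqxx andbT -(has_word_trunc _ _ (leqnn p)) tr Nw.
    apply/forallP => j; rewrite trunc_id // mxrank_krylov_add_delta // word_rankS.
    by rewrite rkN -1?ltnS // (eqP (jv j)).
  move=> v w /addrI /matrixP vw; apply/colP => i; have := vw i p.
  by rewrite !mxE !big_ord1 !mxE !eqxx !mulr1.
move=> M; rewrite !inE => /andP[MR /andP[Mw _]].
by rewrite rref_trunc // has_word_trunc.
Qed.

Lemma card_has_word g : (forall e, g e <= K)%N ->
  #|[set M | rref_upto n M && has_word g n M]|
  = (\prod_(e < n) col_weight #|F| (e \in c) (fun j => height g j e) (g e))%N.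
Proof.
move=> gK; suff cardp p : (p <= n)%N ->
    #|[set M | rref_upto p M && has_word g p M]| =
    (\prod_(e < n | (e < p)%N)
       col_weight #|F| (e \in c) (fun j => height g j e) (g e))%N.
  by rewrite cardp //; apply: eq_bigl => e; rewrite ltn_ord.
elim: p => [_|p IHp lt_pn].
  rewrite big_pred0 // (_ : [set _ | _] = [set 0]) ?cards1 //.
  by apply/setP => M; rewrite !inE andbT rref_upto0.
rewrite -[p]/(val (Ordinal lt_pn)) card_has_wordS // IHp 1?ltnW //.
rewrite [RHS](bigD1 (Ordinal lt_pn)) ?ltnSn //= mulnC; congr (_ * _)%N.
by apply: eq_bigl => e; rewrite -(inj_eq val_inj) /= ltnS ltn_neqAle andbC.
Qed.

(** For each column the jumps are monotone in j and absent at j = 0; the threshold is the letter. *)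
Lemma has_word_exists M :
  exists f : {ffun 'I_n -> 'I_K.+1}, has_word (fun e => f e) n M.
Proof.
have /fin_all_exists[t tP] (p : 'I_n) : exists t : 'I_K.+1, [forall j : 'I_K.+1,
    (jump_mx d p (trunc_mx p M) j *m col p M != 0) == (t < j)%N].
  apply: (@threshold_exists (fun j => jump_mx d p (trunc_mx p M) j *m col p M != 0)).
    by move=> j; apply: jump_mx_mono.
  by rewrite jump_mx0 eqxx.
exists (finfun t).
suff w p : (p <= n)%N -> has_word (fun e => finfun t e) p M by exact: w.
elim: p => // p IHp lt_pn; have w := IHp (ltnW lt_pn); rewrite /= w /=.
apply/forallP => j; rewrite -[p]/(val (Ordinal lt_pn)) truncS.
rewrite mxrank_krylov_add_delta ?col_trunc // word_rankS (has_word_rank w) -1?ltnS //.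
by rewrite (eqP (forallP (tP _) j)) ffunE.
Qed.

(** Restoring column p raises the j-th rank iff its letter is below j, so the ranks of consecutive
    truncations determine the letter. *)
Lemma has_word_unique M (f f' : {ffun 'I_n -> 'I_K.+1}) :
  has_word (fun e => f e) n M -> has_word (fun e => f' e) n M -> f = f'.
Proof.
have wle g p : (p <= n)%N -> has_word g n M -> has_word g p M.
  move=> /subnK <-; elim: (n - p)%N => //= k IHk /andP[/IHk].
  by [].
move=> w w'; apply/ffunP => p; apply/val_inj/eqP.
have lt_j j : (j <= K)%N -> (f p < j)%N = (f' p < j)%N.
  move=> le_jK.
  have := has_word_rank (wle _ p.+1 (ltn_ord p) w) le_jK.
  rewrite (has_word_rank (wle _ p.+1 (ltn_ord p) w') le_jK) !word_rankS.
  rewrite -(has_word_rank (wle _ p (ltnW (ltn_ord p)) w) le_jK).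
  rewrite -(has_word_rank (wle _ p (ltnW (ltn_ord p)) w') le_jK).
  by move=> /addnI; do 2!case: (_ < j)%N.
case: (ltngtP (f p) (f' p)) => // lt; [have := lt_j (f' p) | have := lt_j (f p)].
  by rewrite lt ltnn -ltnS ltn_ord => /(_ isT).
by rewrite lt ltnn -ltnS ltn_ord => /(_ isT).
Qed.

(** Every matrix has exactly one word, and the word fixes all ranks that [P] depends on. *)
Lemma card_rref_by_word (P : (nat -> nat) -> bool) :
    (forall r r', (forall j, j <= K -> r j = r' j)%N -> P r = P r') ->
  #|[set M | rref_upto n M && P (fun j => rk M j)]|
  = (\sum_(f : {ffun 'I_n -> 'I_K.+1} | P (word_rank (fun e => f e) n))
      \prod_(e < n) col_weight #|F| (e \in c)
                      (fun j => height (fun e => f e) j e) (f e))%N.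
Proof.
move=> Pext; have PE f M : rref_upto n M -> has_word (fun e => f e) n M ->
    P (fun j => rk M j) = P (word_rank (fun e => f e) n).
  move=> MR w; apply: Pext => j le_jK.
  by rewrite -{1}(trunc_id MR) (has_word_rank w).
have [t tP] := fin_all_exists has_word_exists.
rewrite -sum1_card (partition_big t (fun f => P (word_rank (fun e => f e) n))) /=.
  apply: eq_bigr => f Pf; rewrite -card_has_word => [|e]; last by rewrite -ltnS.
  rewrite sum1_card; apply: eq_card => M; rewrite unfold_in /= !inE.
  apply/idP/idP => [/andP[/andP[-> _] /eqP <-]|/andP[MR w]]; first exact: tP.
  by rewrite MR (PE _ _ MR w) Pf (has_word_unique (tP M) w) eqxx.
by move=> M; rewrite inE => /andP[MR]; rewrite (PE _ _ MR (tP M)).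
Qed.

End Counting.

(** * Row spaces of matrices as vector subspaces *)

Section RowSpan.
Local Open Scope ring_scope.
Variables (F : fieldType) (n : nat).

Definition rowspan r (A : 'M[F]_(r, n)) : {vspace 'rV[F]_n} :=
  <<[seq row i A | i : 'I_r]>>%VS.

Lemma rowspanE r (A : 'M[F]_(r, n)) : rowspan A = limg (linfun (mulmxr A)).
Proof.
apply/eqP; rewrite eqEsubv; apply/andP; split.
  apply/span_subvP => _ /mapP[i _ ->]; rewrite rowE.
  by apply/memv_imgP; exists (delta_mx 0 i); rewrite ?memvf ?lfunE.
apply/subvP => _ /memv_imgP[u _ ->]; rewrite lfunE /= mulmx_sum_row.
by apply: memv_suml => i _; apply/memvZ/memv_span/image_f.
Qed.

Lemma mem_rowspan r (A : 'M[F]_(r, n)) u : (u \in rowspan A) = (u <= A)%MS.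
Proof.
rewrite rowspanE; apply/memv_imgP/submxP => [[w _ ->]|[w ->]]; exists w.
- by rewrite lfunE.
- exact: memvf.
by rewrite lfunE.
Qed.

Lemma eq_rowspan r1 r2 (A : 'M[F]_(r1, n)) (B : 'M_(r2, n)) :
  (A :=: B)%MS -> rowspan A = rowspan B.
Proof. by move=> eqAB; apply/vspaceP => u; rewrite !mem_rowspan eqAB. Qed.

(** Replacing [A] by a basis of its row space makes the map u -> u A injective. *)
Lemma dim_rowspan r (A : 'M[F]_(r, n)) : \dim (rowspan A) = \rank A.
Proof.
rewrite -(eq_rowspan (eq_row_base A)) rowspanE limg_dim_eq.
  by rewrite dimvf dim_matrix mul1r.
apply/eqP; rewrite -subv0 capfv; apply/subvP => u.
rewrite memv_ker lfunE /= memv0 mulmx_free_eq0 //.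
exact: row_base_free.
Qed.

Lemma rowspan_col_mx r1 r2 (A : 'M[F]_(r1, n)) (B : 'M_(r2, n)) :
  rowspan (col_mx A B) = (rowspan A + rowspan B)%VS.
Proof.
apply/vspaceP => u; rewrite mem_rowspan -addsmxE.
apply/sub_addsmxP/memv_addP => [[[a b] /= ->]|[v vA [w wB ->]]].
  exists (a *m A); first by rewrite mem_rowspan submxMl.
  by exists (b *m B); first by rewrite mem_rowspan submxMl.
move: vA wB; rewrite !mem_rowspan => /submxP[a ->] /submxP[b ->].
by exists (a, b).
Qed.

Lemma lfun_rowspan r (A : 'M[F]_(r, n)) (B : 'M_n) :
  (linfun (mulmxr B) @: rowspan A)%VS = rowspan (A *m B).
Proof.
apply/vspaceP => u; rewrite mem_rowspan; apply/memv_imgP/submxP => [[v]|[w ->]].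
  by rewrite mem_rowspan => /submxP[w ->] ->; exists w; rewrite lfunE /= mulmxA.
by exists (w *m A); rewrite ?mem_rowspan ?submxMl // lfunE /= mulmxA.
Qed.

End RowSpan.

(** * From subspaces to reduced echelon matrices *)

Section Subspaces.
Local Open Scope ring_scope.
Variables (F : finFieldType) (n m : nat) (d : 'rV[F]_n).
Local Notation D := (diag_mx d).

(** Powers of a diagonal matrix are symmetric, so the transpose in [mximg] disappears. *)
Lemma mximg_rowspan r (A : 'M[F]_(r, n)) i :
  mximg (D ^+ i) (rowspan A) = rowspan (A *m D ^+ i).
Proof.
rewrite /mximg (_ : (D ^+ i)^T = D ^+ i) ?lfun_rowspan //.
elim: i => [|i IHi]; first by rewrite !expr0 trmx1.
by rewrite {1}exprS exprSr trmx_mul IHi tr_diag_mx.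
Qed.

Lemma krylov_rowspan (M : 'M[F]_(m, n)) j :
  krylov D (rowspan M) j = rowspan (krylov_mx d M j).
Proof.
rewrite /krylov (eq_bigr _ (fun (i : 'I_j) _ => mximg_rowspan M i)).
elim: j => [|j IHj].
  rewrite big_ord0; apply/vspaceP => u; rewrite mem_rowspan memv0.
  by rewrite eqmx0 submx0.
rewrite big_ord_recl expr0 mulmx1 /= rowspan_col_mx; congr (_ + _)%VS.
rewrite -lfun_rowspan -IHj limg_sum; apply: eq_bigr => i _.
by rewrite lfun_rowspan exprSr mulmxA.
Qed.

(** The profile condition on an arbitrary sequence of dimensions, so that it applies both to Krylov
    ranks and to [word_rank]. *)
Definition profile_ranks (mu : seq nat) (r : nat -> nat) : bool :=
  [forall j : 'I_(size mu).+1, (0 < j)%N ==> (r j == \sum_(i < j) nth 0 mu i)%N]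
  && (r (size mu) == r (size mu).+1).

Lemma has_profile_rowspan mu (M : 'M[F]_(m, n)) :
  has_profile D mu (rowspan M)
  = profile_ranks mu (fun j => \rank (krylov_mx d M j)).
Proof.
rewrite /has_profile /profile_ranks !krylov_rowspan !dim_rowspan; congr (_ && _).
by apply: eq_forallb => j; rewrite krylov_rowspan dim_rowspan.
Qed.

Variable c : m.-tuple 'I_n.
Hypothesis c_sorted : sorted ltn (map val c).

Lemma rref_pivotsE (M : 'M[F]_(m, n)) : rref_pivots c M = rref_upto c n M.
Proof.
rewrite /rref_pivots c_sorted /=; apply/forallP/rref_uptoP => [MP|[M1 M2] i].
  split=> [i j|i i' _].
    rewrite leqNgt ltn_ord /= => ji; have /and3P[_ /forallP/(_ j) + _] := MP i.
    by rewrite ji => /eqP.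
  have /and3P[/eqP + _ /forallP/(_ i')] := MP i.
  by case: eqVneq => [->|_ _ /eqP].
apply/and3P; split; first by rewrite M2 ?eqxx ?ltn_ord.
  by apply/forallP => j; apply/implyP => ji; rewrite M1 ?ji ?orbT.
by apply/forallP => i'; apply/implyP => /negPf ne; rewrite M2 ?ltn_ord // ne.
Qed.

Lemma rref_mulmx (M : 'M[F]_(m, n)) (A : 'M_m) i j :
  rref_upto c n M -> (A *m M) i (tnth c j) = A i j.
Proof.
case/rref_uptoP => _ M2; rewrite mxE (bigD1 j) //= M2 ?ltn_ord // eqxx mulr1.
by rewrite big1 ?addr0 // => k /negPf ne; rewrite M2 ?ltn_ord // ne mulr0.
Qed.

Lemma rref_rank (M : 'M[F]_(m, n)) : rref_upto c n M -> \rank M = m.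
Proof.
move=> MR; apply/eqP/inj_row_free => u uM; apply/rowP => j.
have /rref_uptoP[_ M2] := MR; move/rowP/(_ (tnth c j)): uM.
rewrite !mxE (bigD1 j) //= M2 ?ltn_ord // eqxx mulr1.
by rewrite big1 ?addr0 // => k /negPf ne; rewrite M2 ?ltn_ord // ne mulr0.
Qed.

(** Uniqueness of reduced echelon form: if M = A N, the pivot columns of N being unit vectors, A
    consists of the pivot columns of M and is the identity. *)
Lemma rref_inj : {in rref_upto c n &, injective (@rowspan F n m)}.
Proof.
move=> M N MR NR eqMN; have /submxP[A defM] : (M <= N)%MS.
  by apply/row_subP => i; rewrite -mem_rowspan -eqMN mem_rowspan row_sub.
suff A1 : A = 1%:M by rewrite defM A1 mul1mx.
apply/matrixP => i j; rewrite -(rref_mulmx A i j NR) -defM.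
by have /rref_uptoP[_ ->] := MR; rewrite ?ltn_ord // mxE.
Qed.

Lemma sigmaE mu :
  sigma D c mu = #|[set M : 'M[F]_(m, n) | rref_upto c n M
      && profile_ranks mu (fun j => \rank (krylov_mx d M j))]|.
Proof.
rewrite -(card_in_imset (f := @rowspan F n m)); last first.
  by move=> M N; rewrite !inE => /andP[MR _] /andP[NR _]; apply: rref_inj.
apply: eq_card => W; rewrite inE; apply/and3P/imsetP => [[_]|[M]].
  case/existsP => M /andP[]; rewrite rref_pivotsE => MR /eqP <- prof.
  by exists M; rewrite // inE MR -has_profile_rowspan.
rewrite inE -has_profile_rowspan => /andP[MR prof] ->; split=> //.
  by rewrite dim_rowspan rref_rank.
by apply/existsP; exists M; rewrite rref_pivotsE MR /=.
Qed.

End Subspaces.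

(** * Tableaux as lattice words *)

Section TableauWords.
Variables (n m : nat) (mu : seq nat) (c : m.-tuple 'I_n).
Hypothesis hmu : is_partition mu.
Hypothesis hmu1 : head 0 mu = m.
Hypothesis c_sorted : sorted ltn (map val c).

Local Notation lam := (conj_part mu).
(** The profile condition reaches up to Krylov space [size mu] + 1, hence this bound. Letters below
    [size mu] are columns of the shape, the letter [size mu] never occurs for profile mu, and K
    marks integers outside the support. *)
Local Notation K := (size mu).+1.
Implicit Types (x y z : cell lam) (T : {ffun cell lam -> 'I_n}).
Implicit Type f : {ffun 'I_n -> 'I_K.+1}.

(** In a weakly decreasing sequence the entries exceeding i form an initial segment. *)
Lemma count_partition s i j :
  sorted geq s -> (j < count (fun p => i < p) s) = (i < nth 0 s j).
Proof.
elim: s j => [|a s IHs] j /=; first by rewrite nth_nil.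
move=> geq_s; have /allP le_a := order_path_min (rev_trans leq_trans) geq_s.
have [lt_ia|le_ai] := ltnP i a; last first.
  have -> : count (fun p => i < p) s = 0.
    apply/eqP; rewrite -leqn0 leqNgt -has_count; apply/hasPn => b /le_a le_ba.
    by rewrite -leqNgt (leq_trans le_ba).
  case: j => [|j] /=; first by rewrite [i < a]ltnNge le_ai.
  have [lt_js|le_sj] := ltnP j (size s); last by rewrite nth_default.
  by rewrite [i < _]ltnNge (leq_trans (le_a _ (mem_nth 0 lt_js))).
by case: j => [|j] //=; rewrite add1n ltnS IHs // (path_sorted geq_s).
Qed.

Lemma nth_conj_part i j : i < m -> (j < nth 0 lam i) = (i < nth 0 mu j).
Proof.
move=> lt_im; rewrite nth_mkseq ?hmu1 // count_partition //.
by case/andP: hmu.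
Qed.

Lemma nth_mu_anti i j : i <= j -> nth 0 mu j <= nth 0 mu i.
Proof.
move=> le_ij; rewrite leqNgt -count_partition; last by case/andP: hmu.
apply/negP => /(leq_ltn_trans le_ij).
by rewrite count_partition ?ltnn //; case/andP: hmu.
Qed.

Lemma nth_mu_leq j : nth 0 mu j <= m.
Proof. by rewrite -hmu1 -nth0 nth_mu_anti. Qed.

Lemma cell_row_lt x : cell_row x < nth 0 mu (cell_col x).
Proof.
case: x => i j; rewrite -nth_conj_part /cell_row /cell_col /= ?ltn_ord //.
by have := ltn_ord i; rewrite {2}size_mkseq hmu1.
Qed.

Lemma cell_exists i j : i < nth 0 mu j ->
  exists2 x : cell lam, cell_row x = i & cell_col x = j.
Proof.
move=> lt_ij; have lt_im : i < m by apply: leq_trans lt_ij (nth_mu_leq j).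
have lt_i : i < size lam by rewrite size_mkseq hmu1.
have lt_j : j < nth 0 lam (Ordinal lt_i) by rewrite nth_conj_part.
by exists (Tagged (fun i : 'I_(size lam) => 'I_(nth 0 lam i)) (Ordinal lt_j)).
Qed.

Lemma cell_inj x y : cell_row x = cell_row y -> cell_col x = cell_col y -> x = y.
Proof.
case: x y => i j [i' j']; rewrite /cell_row /cell_col /= => /val_inj eq_i.
by case: i' / eq_i j' => j' /val_inj ->.
Qed.

Lemma cell_col_lt x : cell_col x < size mu.
Proof.
by rewrite ltnNge; apply/negP => le; have := cell_row_lt x; rewrite nth_default.
Qed.

Lemma cell_col_ltS x : cell_col x < K.
Proof. exact: leqW (cell_col_lt x). Qed.

Lemma card_cells_above i j : i <= nth 0 mu j ->
  #|[set y : cell lam | (cell_col y == j) && (cell_row y < i)]| = i.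
Proof.
elim: i => [_|i IHi lt_i].
  by apply/eqP; rewrite cards_eq0; apply/eqP/setP => y; rewrite !inE andbF.
have [x xi xj] := cell_exists lt_i.
rewrite (cardsD1 x) inE xi xj eqxx ltnSn -[in RHS](IHi (ltnW lt_i)) add1n.
congr _.+1; apply: eq_card => y; rewrite !inE.
have [->|ne] := eqVneq y x; first by rewrite xi ltnn andbF.
case: eqP => //= yj; rewrite ltnS leq_eqVlt; case: eqP => //= yi.
by case/eqP: ne; apply: cell_inj; rewrite ?xi ?xj.
Qed.

Definition tableau_word T : {ffun 'I_n -> 'I_K.+1} :=
  [ffun e => inord (if [pick x | T x == e] is Some x then cell_col x else K)].

Local Notation ht f := (height (fun e => nat_of_ord (f e))).
Local Notation wT T := (tableau_word T).

Section OneTableau.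
Variable T : {ffun cell lam -> 'I_n}.
Hypothesis T_inj : injective T.

Lemma tableau_wordE x : wT T (T x) = cell_col x :> nat.
Proof.
rewrite ffunE; case: pickP => [y /eqP/T_inj ->|/(_ x)]; last by rewrite eqxx.
by rewrite inordK // (ltn_trans (cell_col_lt x)) // leqW.
Qed.

Lemma tableau_word_out e : (forall x, T x != e) -> wT T e = K :> nat.
Proof.
move=> eNT; rewrite ffunE; case: pickP => [x|_]; first by rewrite (negPf (eNT x)).
by rewrite inordK.
Qed.

Lemma height_tableau_word j p : j < K ->
  ht (wT T) j p = #|[set y : cell lam | (cell_col y == j) && (T y < p)]|.
Proof.
move=> lt_jK; rewrite -(card_imset _ T_inj); apply: eq_card => e; rewrite inE.
apply/andP/imsetP => [[lt_ep /eqP we]|[y + ->]]; last first.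
  by rewrite inE tableau_wordE => /andP[].
have [x /eqP Tx|out] := pickP (fun x => T x == e).
  by exists x; rewrite // inE Tx lt_ep andbT -we -Tx tableau_wordE.
move: lt_jK; rewrite -we tableau_word_out ?ltnn // => x.
by rewrite out.
Qed.

Lemma height_tableau_word_total j : j < K -> ht (wT T) j n = nth 0 mu j.
Proof.
move=> lt_jK; rewrite height_tableau_word // -[RHS](card_cells_above (leqnn _)).
apply: eq_card => y; rewrite !inE ltn_ord andbT.
by case: eqP => //= <-; rewrite cell_row_lt.
Qed.

Hypothesis T_row : forall x y,
  cell_row x = cell_row y -> cell_col x < cell_col y -> T x < T y.
Hypothesis T_col : forall x y,
  cell_col x = cell_col y -> cell_row x < cell_row y -> T x < T y.

Lemma height_tableau_word_row x : ht (wT T) (cell_col x) (T x) = cell_row x.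
Proof.
rewrite height_tableau_word ?cell_col_ltS //.
rewrite -[RHS](card_cells_above (ltnW (cell_row_lt x))).
apply: eq_card => y; rewrite !inE; case: eqP => //= yx.
case: (ltngtP (cell_row y) (cell_row x)) => [lt|lt|eq].
- exact: T_col.
- by rewrite ltnNge ltnW // T_col.
by rewrite (cell_inj eq yx) ltnn.
Qed.

(** Among the entries of the preceding column smaller than [T x], those in rows above x are all
    present, and the rest are what [c_cell] counts. *)
Lemma c_cell_height x j : cell_col x = j.+1 ->
  ht (wT T) j (T x) = cell_row x + c_cell T x.
Proof.
move=> xj; have le_x : cell_row x <= nth 0 mu j.
  by rewrite ltnW // (leq_trans (cell_row_lt x)) // nth_mu_anti // xj.
rewrite height_tableau_word; last by rewrite (ltn_trans _ (cell_col_ltS x)) ?xj.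
rewrite -(cardsID [set y : cell lam | cell_row y < cell_row x]); congr (_ + _).
  rewrite -[RHS](card_cells_above le_x); apply: eq_card => y; rewrite !inE.
  case: eqP => //= yj; case: (ltnP (cell_row y) (cell_row x)) => [lt_yx|];
    rewrite ?andbF // andbT.
  (* The right neighbour y' of y lies above x in its column, so T y < T y' < T x. *)
  have [y' y'x y'j] : exists2 y' : cell lam,
      cell_row y' = cell_row y & cell_col y' = j.+1.
    by apply: cell_exists; rewrite -xj; apply: ltn_trans (cell_row_lt x).
  apply: (@ltn_trans (T y')); first by apply: T_row; rewrite ?yj ?y'j.
  by apply: T_col; rewrite ?xj ?y'x.
apply: eq_card => y; rewrite !inE -leqNgt xj eqSS andbA; congr (_ && _).
Qed.

End OneTableau.

Lemma multilinear_tableauP T :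
  reflect [/\ injective T,
     forall x y, cell_row x = cell_row y -> cell_col x < cell_col y -> T x < T y
   & forall x y, cell_col x = cell_col y -> cell_row x < cell_row y -> T x < T y]
  (multilinear_tableau T).
Proof.
apply: (iffP and3P) => [[/injectiveP Ti /forallP Tr /forallP Tc]|[Ti Tr Tc]]; split=> //.
- move=> x y /eqP xy lt; have /forallP/(_ y) := Tr x.
  by rewrite xy lt.
- move=> x y /eqP xy lt; have /forallP/(_ y) := Tc x.
  by rewrite xy lt.
- exact/injectiveP.
- apply/forallP => x; apply/forallP => y; apply/implyP => /andP[/eqP xy lt].
  exact: Tr.
apply/forallP => x; apply/forallP => y; apply/implyP => /andP[/eqP xy lt].
exact: Tc.
Qed.

Lemma first_columnP T :
  reflect (forall x (i : 'I_m), cell_col x = 0 -> cell_row x = i -> T x = tnth c i)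
          (first_column c T).
Proof.
have onthc (i : 'I_m) : onth c i = Some (tnth c i).
  by rewrite onthE (nth_map (tnth c i)) ?size_tuple // -tnth_nth.
rewrite /first_column size_mkseq hmu1 eqxx; apply: (iffP forallP) => cT x.
  by move=> i x0 xi; have := cT x; rewrite x0 xi onthc => /eqP[].
apply/implyP => /eqP x0; have lt_xm := leq_trans (cell_row_lt x) (nth_mu_leq _).
by rewrite -[cell_row x]/(val (Ordinal lt_xm)) onthc (cT x (Ordinal lt_xm)).
Qed.

Lemma tnth_ltn (i i' : 'I_m) : (tnth c i < tnth c i') = (i < i').
Proof.
have mono (k l : 'I_m) : k < l -> tnth c k < tnth c l.
  move=> lt_kl; have := sorted_ltn_nth ltn_trans 0 c_sorted.
  move=> /(_ k l); rewrite !inE size_map size_tuple !ltn_ord => /(_ isT isT lt_kl).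
  by rewrite !(nth_map (tnth c k)) ?size_tuple // -!tnth_nth.
case: (ltngtP i i') => [/mono //|/mono lt|/val_inj ->]; last by rewrite ltnn.
by rewrite ltnNge ltnW.
Qed.

Lemma card_below_tnth (i : 'I_m) : #|[set e in c | e < tnth c i]| = i.
Proof.
have ci : injective (tnth c).
  move=> k l eq_kl; apply/val_inj; case: (ltngtP k l) => // lt.
    by move: lt; rewrite -tnth_ltn eq_kl ltnn.
  by move: lt; rewrite -tnth_ltn eq_kl ltnn.
have -> : [set e in c | e < tnth c i] = tnth c @: [set k : 'I_m | k < i].
  apply/setP => e; rewrite inE; apply/andP/imsetP => [[/tnthP[k ->] lt]|[k + ->]].
    by exists k; rewrite // inE -tnth_ltn.
  by rewrite inE tnth_ltn mem_tnth.
rewrite card_imset // -sum1dep_card.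
rewrite -(big_ord_widen_cond m predT (fun _ => 1)) 1?ltnW //.
by rewrite sum1_card card_ord.
Qed.

(** Column lengths mu, first column C, and the lattice condition: an entry put into a later column
    must find the preceding column strictly longer. *)
Definition good_word f : bool :=
  [&& [forall j : 'I_K, ht f j n == nth 0 mu j],
      [forall e, (f e == 0 :> nat) == (e \in c)]
    & [forall e, (0 < f e < K) ==> (ht f (f e) e < ht f (f e).-1 e)]].

Lemma good_wordP f :
  reflect [/\ forall j, j < K -> ht f j n = nth 0 mu j,
              forall e, (f e == 0 :> nat) = (e \in c)
            & forall e, 0 < f e < K -> ht f (f e) e < ht f (f e).-1 e]
          (good_word f).
Proof.
apply: (iffP and3P) => [[/forallP f1 /forallP f2 /forallP f3]|[f1 f2 f3]]; split.
- by move=> j lt_jK; have /eqP := f1 (Ordinal lt_jK).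
- by move=> e; have /eqP := f2 e.
- by move=> e fe; have := f3 e; rewrite fe.
- by apply/forallP => j; rewrite f1.
- by apply/forallP => e; rewrite f2.
by apply/forallP => e; apply/implyP => /f3.
Qed.

Lemma tableau_word_good T :
  multilinear_tableau T && first_column c T -> good_word (wT T).
Proof.
case/andP => /multilinear_tableauP[Ti Tr Tc] /first_columnP T1.
apply/good_wordP; split=> [j lt_jK|e|e].
- exact: height_tableau_word_total.
- apply/eqP/idP => [we|/tnthP[i ->]].
    have [x /eqP Tx|out] := pickP (fun x => T x == e); last first.
      by move: we; rewrite tableau_word_out // => x; rewrite out.
    move: we; rewrite -Tx tableau_wordE // => x0.
    have lt_xm := leq_trans (cell_row_lt x) (nth_mu_leq _).
    by rewrite (T1 x (Ordinal lt_xm)) ?mem_tnth.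
  have [x xi x0] : exists2 x : cell lam, cell_row x = i & cell_col x = 0.
    by apply: cell_exists; rewrite nth0 hmu1.
  by rewrite -(T1 x i) // tableau_wordE.
have [x /eqP <-|out] := pickP (fun x => T x == e); last first.
  by rewrite tableau_word_out ?ltnn ?andbF // => x; rewrite out.
rewrite tableau_wordE // height_tableau_word_row //.
case xj : (cell_col x) => [|j] //= _; rewrite c_cell_height // -[ltnLHS]addn0.
rewrite ltn_add2l card_gt0; apply/set0Pn.
(* The left neighbour z of x is counted by [c_cell], which is therefore positive. *)
have [z zr zj] : exists2 z : cell lam, cell_row z = cell_row x & cell_col z = j.
  apply: cell_exists; apply: leq_trans (cell_row_lt x) _.
  by apply: nth_mu_anti; rewrite xj.
by exists z; rewrite inE zr leqnn zj xj eqxx /= Tr // zj xj.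
Qed.

(** [T x] is the entry of its column whose height is the row of x, so the word determines it. *)
Lemma tableau_word_inj :
  {in [pred T | multilinear_tableau T] &, injective tableau_word}.
Proof.
move=> T T' /multilinear_tableauP[Ti _ Tc] /multilinear_tableauP[Ti' _ Tc'] eqw.
apply/ffunP => x; apply: (@height_inj _ (fun e => wT T e)).
  by rewrite {2}eqw !tableau_wordE.
rewrite tableau_wordE // {2}eqw !height_tableau_word_row //.
Qed.

(** The cell in row i and column j receives the entry with letter j and height i. Columns then
    increase by construction, and rows by the lattice condition. *)
Lemma tableau_word_surj f : good_word f ->
  exists2 T, multilinear_tableau T && first_column c T & f = wT T.
Proof.
case/good_wordP => f1 f2 f3.
have /fin_all_exists[t tP] x : exists e : 'I_n,
    f e = cell_col x :> nat /\ ht f (cell_col x) e = cell_row x.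
  have xr : cell_row x < ht f (cell_col x) n.
    by rewrite f1 ?cell_row_lt // cell_col_ltS.
  by have [e [_ fe he]] := height_surj xr; exists e.
have tf x : f (t x) = cell_col x :> nat by case: (tP x).
have th x : ht f (cell_col x) (t x) = cell_row x by case: (tP x).
have t_inj : injective t.
  by move=> x y txy; apply: cell_inj; [rewrite -!th -!tf txy | rewrite -!tf txy].
(* If t y <= t x, then just before t y the column of x would have height at most the common row,
   against the lattice condition at t y. *)
have t_step x y : cell_row x = cell_row y -> cell_col y = (cell_col x).+1 -> t x < t y.
  move=> eq_r yx; rewrite ltnNge; apply/negP => le_t.
  have := f3 (t y); rewrite tf th cell_col_ltS yx => /(_ isT).
  by rewrite ltnNge -eq_r -th (leq_height _ _ le_t).
have t_row x y : cell_row x = cell_row y -> cell_col x < cell_col y -> t x < t y.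
  move=> eq_r; move ej : (cell_col y) => j; elim: j y eq_r ej => // j IHj y eq_r ej.
  rewrite ltnS => le_xj; have [z zr zj] : exists2 z : cell lam,
      cell_row z = cell_row y & cell_col z = j.
    apply: cell_exists; apply: leq_trans (cell_row_lt y) _.
    by apply: nth_mu_anti; rewrite ej.
  have lt_zy : t z < t y by apply: t_step; rewrite ?zj.
  move: le_xj; rewrite leq_eqVlt => /orP[/eqP xj|lt_xj].
    by have -> : x = z by apply: cell_inj; rewrite ?zr ?zj.
  by apply: ltn_trans lt_zy; apply: IHj; rewrite ?zr.
have t_col x y : cell_col x = cell_col y -> cell_row x < cell_row y -> t x < t y.
  move=> eq_c; rewrite -!th eq_c; apply: contraTT; rewrite -!leqNgt.
  exact: leq_height.
have T_inj : injective (finfun t) by move=> x y; rewrite !ffunE => /t_inj.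
exists (finfun t).
  apply/andP; split.
    by apply/multilinear_tableauP; split=> // x y; rewrite !ffunE; auto.
  apply/first_columnP => x i x0 xi; rewrite ffunE.
  have : t x \in c by rewrite -f2 tf x0.
  case/tnthP => i' txi'; suff -> : i = i' by [].
  (* Both indices count the elements of C smaller than t x. *)
  apply: val_inj; rewrite /= -xi -th x0 txi' -[RHS]card_below_tnth.
  by apply: eq_card => e; rewrite !inE f2 andbC.
apply/ffunP => e; apply: val_inj => /=.
have [lt_fe|ge_fe] := ltnP (f e) K.
  have lt_h : ht f (f e) e < nth 0 mu (f e) by rewrite -f1 // ltn_height.
  have [x xr xc] := cell_exists lt_h.
  have <- : finfun t x = e.
    rewrite ffunE; apply: (@height_inj _ (fun e => nat_of_ord (f e))).
      by rewrite tf xc.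
    by rewrite tf th xc xr.
  by rewrite tableau_wordE // ffunE tf.
rewrite tableau_word_out; last first.
  move=> x; apply/eqP => xe; move: ge_fe; rewrite -xe ffunE tf.
  by rewrite leqNgt cell_col_ltS.
by apply/eqP; rewrite eqn_leq ge_fe -ltnS ltn_ord.
Qed.

(** The product c_q(T) read off the word. Truncated subtraction turns a failure of the lattice
    condition into a factor [0]_q = 0. *)
Definition word_weight q f : nat :=
  \prod_(e < n | 0 < f e < K) qint q (ht f (f e).-1 e - ht f (f e) e).

Lemma c_q_word q T : multilinear_tableau T -> c_q q T = word_weight q (wT T).
Proof.
case/multilinear_tableauP => Ti Tr Tc.
have -> : c_q q T = \prod_(x in [set x : cell lam | 0 < cell_col x])
    qint q (ht (wT T) (wT T (T x)).-1 (T x) - ht (wT T) (wT T (T x)) (T x)).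
  apply: eq_big => [x|x]; first by rewrite inE.
  case xj : (cell_col x) => [|j] // _; rewrite tableau_wordE //.
  by rewrite height_tableau_word_row // xj c_cell_height // addKn.
rewrite -(big_imset (fun e => qint q (ht (wT T) (wT T e).-1 e - ht (wT T) (wT T e) e))).
  apply: eq_bigl => e; apply/imsetP/idP => [[x + ->]|we].
    by rewrite inE tableau_wordE // cell_col_ltS => ->.
  have [x /eqP Tx|out] := pickP (fun x => T x == e).
    by exists x => //; move: we; rewrite inE -Tx tableau_wordE // => /andP[].
  by move: we; rewrite tableau_word_out ?ltnn ?andbF // => x; rewrite out.
by move=> x y _ _; apply: Ti.
Qed.

Lemma sum_c_q_word q :
  \sum_(T : {ffun cell lam -> 'I_n} | multilinear_tableau T && first_column c T) c_q q T
  = \sum_(f | good_word f) word_weight q f.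
Proof.
pose A := [set T : {ffun cell lam -> 'I_n} | multilinear_tableau T && first_column c T].
have -> : \sum_(f | good_word f) word_weight q f
          = \sum_(f in tableau_word @: A) word_weight q f.
  apply: eq_bigl => f; apply/idP/imsetP => [/tableau_word_surj[T TP ->]|[T + ->]].
    by exists T; rewrite ?inE.
  by rewrite inE; apply: tableau_word_good.
rewrite big_imset; last first.
  move=> T T'; rewrite !inE => /andP[TP _] /andP[TP' _].
  by apply: tableau_word_inj; rewrite inE.
apply: eq_big => T; first by rewrite inE.
by case/andP => TP _; rewrite c_q_word.
Qed.

Lemma sum_by_column f (H : 'I_n -> nat) :
    (forall j, j < K -> ht f j n = nth 0 mu j) ->
  \sum_(e < n | 0 < f e < K) H e
  = \sum_(1 <= j < size mu) \sum_(e < n | f e == j :> nat) H e.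
Proof.
(* Column [size mu] has height [nth 0 mu (size mu)], the default 0, so this letter does not
   occur. *)
move=> f1; have no_k e : f e != size mu :> nat.
  apply/eqP => fe; have := @ltn_height _ (fun e => f e) _ e n (ltn_ord e) fe.
  by rewrite f1 // nth_default.
rewrite (exchange_big_dep predT) //= [LHS]big_mkcond; apply: eq_bigr => e _.
rewrite (eq_bigl (fun j : nat => j == f e :> nat)) => [|j]; last by rewrite eq_sym.
by rewrite big_nat1_eq [f e < K]ltnS [f e <= _]leq_eqVlt (negPf (no_k e)).
Qed.

(** Subtraction is truncated: for a <= b both sides are 0, so the identity also covers words that
    are not lattice words. *)
Lemma expn_sub_qint q a b : 0 < q -> q ^ a - q ^ b = (q - 1) * q ^ b * qint q (a - b).
Proof.
move=> q_gt0; have [le_ab|lt_ba] := leqP a b.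
  have /eqP -> : q ^ a - q ^ b == 0 by rewrite subn_eq0 leq_pexp2l.
  by rewrite (eqP (le_ab : a - b == 0)) /qint big_ord0 muln0.
rewrite -{1}(subnKC (ltnW lt_ba)) expnD -{2}[q ^ b]muln1 -mulnBr subn1 predn_exp.
by rewrite subn1 mulnA [q ^ b * _]mulnC.
Qed.

Lemma word_product q f : 0 < q -> (forall j, j < K -> ht f j n = nth 0 mu j) ->
  \prod_(e < n) col_weight K q (e \in c) (fun j => ht f j e) (f e)
  = if good_word f
    then (q - 1) ^ (\sum_(1 <= j < size mu) nth 0 mu j)
         * q ^ (\sum_(1 <= j < size mu) 'C(nth 0 mu j, 2)) * word_weight q f
    else 0.
Proof.
move=> q_gt0 f1; have [/existsP[e]|/existsPn f2] :=
    boolP [exists e, (f e == 0 :> nat) != (e \in c)].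
  move=> ne_e; case: ifP => [/good_wordP[_ f2 _]|_]; first by rewrite f2 eqxx in ne_e.
  (* A letter 0 off C, or a nonzero letter on C, makes its factor vanish. *)
  apply/eqP; rewrite (bigD1 e) //= muln_eq0 /col_weight; apply/orP; left.
  by move: ne_e; case: (f e == 0 :> nat); case: (e \in c).
have {}f2 e : (f e == 0 :> nat) = (e \in c) by have := f2 e; rewrite negbK => /eqP.
have wtE : \prod_(e < n) col_weight K q (e \in c) (fun j => ht f j e) (f e)
  = \prod_(e < n | 0 < f e < K)
      ((q - 1) * q ^ ht f (f e) e * qint q (ht f (f e).-1 e - ht f (f e) e)).
  rewrite [RHS]big_mkcond; apply: eq_bigr => e _; rewrite /col_weight -f2 lt0n.
  case: eqP => //= /eqP fe0; rewrite mul1n ltn_neqAle -ltnS ltn_ord andbT.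
  case: eqP => //= [fK|_]; last exact: expn_sub_qint.
  (* A letter K contributes q^0 = 1, since column K - 1 = [size mu] is empty. *)
  rewrite fK /= (_ : ht f _ e = 0) //; apply/eqP; rewrite -leqn0.
  by rewrite -(nth_default 0 (leqnn (size mu))) -f1 // leq_height // ltnW.
have powE : \prod_(e < n | 0 < f e < K)
      ((q - 1) * q ^ ht f (f e) e * qint q (ht f (f e).-1 e - ht f (f e) e))
    = (q - 1) ^ (\sum_(1 <= j < size mu) nth 0 mu j)
         * q ^ (\sum_(1 <= j < size mu) 'C(nth 0 mu j, 2)) * word_weight q f.
  rewrite !big_split /=; congr (_ * _ * _).
    rewrite prod_nat_const -sum1_card sum_by_column //; congr (_ ^ _).
    apply: eq_big_nat => j /andP[_ lt_j]; rewrite -f1 ?leqW // sum1dep_card.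
    by apply: eq_card => e; rewrite !inE ltn_ord.
  rewrite -expn_sum sum_by_column //; congr (_ ^ _).
  apply: eq_big_nat => j /andP[_ lt_j]; rewrite -f1 ?leqW // -sum_height_bin //.
  by apply: eq_big => [e|e /eqP ->]; rewrite ?ltn_ord.
rewrite wtE powE; case: ifPn => // ngood.
suff -> : word_weight q f = 0 by rewrite muln0.
(* A place where the lattice condition fails gives the factor [0]_q. *)
have /existsP[e] : [exists e, (0 < f e < K) && (ht f (f e).-1 e <= ht f (f e) e)].
  apply: contraNT ngood => /existsPn f3; apply/good_wordP; split=> // e fe.
  by have := f3 e; rewrite fe /= -ltnNge.
case/andP => fe /eqP le_e; apply/eqP; rewrite /word_weight (bigD1 e) //= le_e.
by rewrite /qint big_ord0.
Qed.

Lemma profile_word_rank (g : 'I_n -> nat) :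
  reflect (forall j, j < K -> height g j n = nth 0 mu j)
          (profile_ranks mu (word_rank g n)).
Proof.
apply: (iffP andP) => [[/forallP r1 /eqP r2]|h].
  have rE j : j <= K -> word_rank g n j = \sum_(i < j) nth 0 mu i.
    have rE' l : l <= size mu -> word_rank g n l = \sum_(i < l) nth 0 mu i.
      case: l => [|l] le_l; first by rewrite /word_rank !big_ord0.
      by have /eqP := implyP (r1 (Ordinal (le_l : l.+1 < K))) isT.
    (* The case j = K uses the stability of the Krylov spaces, matched by the default part 0. *)
    rewrite leq_eqVlt => /orP[/eqP ->|]; last exact: rE'.
    by rewrite -r2 rE' // big_ord_recr /= nth_default // addn0.
  move=> j lt_jK; have := rE j.+1 lt_jK.
  by rewrite /word_rank !big_ord_recr /= -/(word_rank g n j) rE 1?ltnW // => /addnI.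
have rE j : j <= K -> word_rank g n j = \sum_(i < j) nth 0 mu i.
  by move=> le_jK; apply: eq_bigr => i _; rewrite h // (leq_trans (ltn_ord i)).
split; last by rewrite !rE // big_ord_recr /= nth_default // addn0.
by apply/forallP => j; apply/implyP => _; rewrite rE // ltnW.
Qed.

End TableauWords.

(** * The sum over words equals the sum over tableaux *)

Theorem theorem4p14 (F : finFieldType) (q n m : nat) (hq : #|F| = q)
    (D : 'M[F]_n) (hD : is_diag_mx D) (hDinj : injective (fun i => D i i))
    (c : m.-tuple 'I_n) (hc : sorted ltn (map val c))
    (mu : seq nat) (hmu : is_partition mu) (hmu1 : head 0 mu = m) :
  sigma D c mu =
    (q - 1) ^ (\sum_(1 <= j < size mu) nth 0 mu j)
    * q ^ (\sum_(1 <= j < size mu) 'C(nth 0 mu j, 2))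
    * \sum_(T : {ffun cell (conj_part mu) -> 'I_n}
             | multilinear_tableau T && first_column c T) c_q q T.
Proof.
pose d := (\row_j D j j)%R.
have -> : D = diag_mx d.
  apply/matrixP => i j; rewrite !mxE; case: eqVneq => [->//|ne].
  by rewrite (is_diag_mxP hD).
have d_inj : injective (d 0%R) by move=> i j; rewrite !mxE => /hDinj.
have c_inj : injective (tnth c).
  move=> k l eq_kl; apply/val_inj; case: (ltngtP k l) => //;
  by rewrite -(tnth_ltn hc) eq_kl ltnn.
have q_gt0 : 0 < q by rewrite -hq; apply/card_gt0P; exists 0%R.
rewrite sigmaE // (card_rref_by_word d_inj c_inj (ltn0Sn (size mu))) => [|r r' rr'];
  last first.
  rewrite /profile_ranks !rr' //; congr (_ && _); apply: eq_forallb => j.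
  by rewrite rr' // ltnW.
rewrite sum_c_q_word // big_distrr /= hq.
(* Both sides become sums over all words and are compared termwise; words with column lengths other
   than mu contribute 0 to each. *)
rewrite [RHS](big_mkcond (good_word (mu := mu) c)) [LHS]big_mkcond /=.
apply: eq_bigr => f _.
case: profile_word_rank => [f1|nf1]; first exact: word_product.
by case: ifP => // /good_wordP[].
Qed.
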